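(* Let $n\ge 1$ and $d\ge 1$ be integers, and let $f,g\in\mathbb{C}[x_1,\ldots,x_n]_d$ be two homogeneous polynomials of degree $d$ whose Jacobian ideals coincide, $\mathcal{J}_f=\mathcal{J}_g$. Then $f$ and $g$ are right-equivalent, $f\stackrel{\mathcal{R}}{\sim}g$.
   Context: $\mathbb{C}[x_1,\ldots,x_n]_d$ (also denoted $H^d(n,1;\mathbb{C})$ or $H^d$) is the complex vector space of homogeneous polynomials of degree $d$ in $x_1,\ldots,x_n$ (including $0$). For $f\in\mathbb{C}[x_1,\ldots,x_n]$, the Jacobian ideal is $\mathcal{J}_f=\left\langle \frac{\partial f}{\partial x_1},\ldots,\frac{\partial f}{\partial x_n}\right\rangle\subset\mathbb{C}[x_1,\ldots,x_n]$. No assumption of isolated singularities at the origin is made. Right equivalence $f\stackrel{\mathcal{R}}{\sim}g$ on $\mathbb{C}[x_1,\ldots,x_n]_d$ means that $f$ and $g$ lie in the same orbit of the action of $GL(n,\mathbb{C})$ by linear change of coordinates, i.e. there is a linear isomorphism $u:\mathbb{C}^n\to\mathbb{C}^n$ with $f=g\circ u$. (For homogeneous polynomials of the same degree $d\geq 1$ this is equivalent to the existence of a germ of biholomorphism $h:(\mathbb{C}^n,0)\to(\mathbb{C}^n,0)$ with $f=g\circ h$.) *)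

(* Defs.v *)
From HB Require Import structures.
From mathcomp Require Import all_boot all_order all_algebra.
From mathcomp Require Import mpoly.

Set Implicit Arguments.
Unset Strict Implicit.
Unset Printing Implicit Defensive.

Import GRing.Theory.
Local Open Scope ring_scope.

Definition ideal_gen (A : comNzRingType) (I : finType) (a : I -> A) (p : A) : Prop :=
  exists c : I -> A, p = \sum_i c i * a i.

Definition jacobian_ideal (K : comNzRingType) (n : nat) (f : {mpoly K[n]}) :
    {mpoly K[n]} -> Prop :=
  ideal_gen (fun i : 'I_n => f^`M(i)).

(* [lin_subst A g] is the polynomial g \o u, where u is the linear map        *)
(* x |-> A x of K^n, with x a column vector; see [meval_lin_subst].           *)
Definition lin_subst (K : comNzRingType) (n : nat) (A : 'M[K]_n)
    (g : {mpoly K[n]}) : {mpoly K[n]} :=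
  g \mPo [tuple \sum_j A i j *: 'X_j | i < n].

Lemma meval_lin_subst (K : comNzRingType) (n : nat) (A : 'M[K]_n)
    (g : {mpoly K[n]}) (x : 'cV[K]_n) :
  (lin_subst A g).@[fun i => x i 0] = g.@[fun i => (A *m x) i 0].
Proof.
rewrite /lin_subst comp_mpoly_meval; apply: meval_eq => i.
rewrite tnth_map tnth_ord_tuple mxE raddf_sum; apply: eq_bigr => j _ /=.
by rewrite mevalZ mevalXU.
Qed.

Definition right_equivalent (K : comUnitRingType) (n : nat) (f g : {mpoly K[n]}) : Prop :=
  exists2 A : 'M[K]_n, A \in unitmx & f = lin_subst A g.

(* Main.v *)
(* Equality of the Jacobian ideals gives, in degree d - 1, an invertible A with
   grad f = A grad g.  As A Hess(g) = Hess(f) is symmetric, C = A^T is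
   self-adjoint for the symmetric d-linear form G of g, and so is every
   polynomial B in C.  By Euler's formula f(x) = G(Cx, x, ..., x), whereas
   g(Bx) = G(Bx, ..., Bx) = G(B^d x, x, ..., x); it remains to take for B a d-th
   root of C among the polynomials in C, which exists since C is invertible. *)
Require Import Defs.
From HB Require Import structures.
From mathcomp Require Import all_boot all_order all_algebra.
From mathcomp Require Import reals complex.
From mathcomp Require Import mpoly.

Set Implicit Arguments.
Unset Strict Implicit.
Unset Printing Implicit Defensive.

Local Open Scope ring_scope.

Import GRing.Theory Num.Theory.

(** * Roots modulo a polynomial and roots of invertible matrices *)

(* Induction on the roots a of q: adding to p a multiple of q, one interpolates a
   d-th root of a at a new root, and makes a Hensel step at a repeated one. *)
Lemma exists_root_mod_poly (K : numClosedFieldType) (d : nat) (q : {poly K}) :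
  (0 < d)%N -> ~~ root q 0 -> exists p : {poly K}, q %| p ^+ d - 'X.
Proof.
move=> d_gt0; have [rs ->] := closed_field_poly_normal q.
have [->|q0] := eqVneq (lead_coef q) 0.
  by rewrite scale0r root0.
rewrite rootZ // => nz_rs; suff [p qp] : exists p : {poly K},
    \prod_(z <- rs) ('X - z%:P) %| p ^+ d - 'X.
  by exists p; rewrite dvdpZl.
elim: rs nz_rs {q q0} => [|a rs IHrs]; first by exists 0; rewrite big_nil dvd1p.
rewrite big_cons rootM root_XsubC negb_or => /andP[a_neq0 /IHrs[p]].
set q := \prod_(z <- rs) _ => /dvdpP[s def_s].
have [qa|nqa] := boolP (root q a).
  have pa : p.[a] ^+ d = a.
    apply/eqP; rewrite -subr_eq0; have := congr1 (horner^~ a) def_s.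
    by rewrite !hornerE (rootP qa) mulr0 => ->.
  have pa_neq0 : p.[a] != 0.
    by apply: contra a_neq0 => /eqP p0; rewrite -pa p0 expr0n gtn_eqF.
  (* As [q] vanishes at [a], the quotient of (p + c q)^d - X by q takes the value s(a) + c d
     p(a)^(d-1) at [a]; this [c] makes it zero. *)
  pose c := - s.[a] / (p.[a] ^+ d.-1 *+ d).
  have nz : p.[a] ^+ d.-1 *+ d != 0.
    by rewrite mulrn_eq0 negb_or -lt0n d_gt0 expf_neq0.
  exists (p + c *: q).
  have -> : (p + c *: q) ^+ d - 'X = (p + c *: q) ^+ d - p ^+ d + (p ^+ d - 'X).
    by rewrite addrA subrK.
  rewrite def_s subrXX addrAC subrr add0r -scalerAl scalerAr [q * _]mulrC -mulrDl.
  rewrite dvdp_mul // dvdp_XsubCl; apply/rootP.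
  rewrite !hornerE horner_sum (eq_bigr (fun=> p.[a] ^+ d.-1)); last first.
    move=> i _; rewrite !hornerE (rootP qa) mulr0 addr0 -exprD.
    by rewrite subnK // -ltnS prednK.
  by rewrite sumr_const card_ord /c divfK // addNr.
pose b := d.-root a.
(* Adding a multiple of [q] preserves the congruence modulo [q]; this one gives the value [b] at
   [a]. *)
pose c := (b - p.[a]) / q.[a].
exists (p + c *: q); rewrite Gauss_dvdp; last first.
  by rewrite coprimep_sym coprimep_XsubC.
apply/andP; split.
  rewrite dvdp_XsubCl; apply/rootP.
  by rewrite !hornerE /c divfK // [p.[a] + _]addrC subrK rootCK // subrr.
have -> : (p + c *: q) ^+ d - 'X = (p + c *: q) ^+ d - p ^+ d + (p ^+ d - 'X).
  by rewrite addrA subrK.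
apply: dvdp_add; last by rewrite def_s dvdp_mull.
by rewrite subrXX addrAC subrr add0r dvdp_mulr // -mul_polyC dvdp_mull.
Qed.

(** By Cayley-Hamilton, a d-th root of X modulo the characteristic polynomial of [C], evaluated at
    [C], is a d-th root of [C]. Invertibility ensures that 0 is not an eigenvalue. *)
Lemma exists_unitmx_root (K : numClosedFieldType) (n d : nat) (C : 'M[K]_n.+1) :
  (0 < d)%N -> C \in unitmx -> exists p : {poly K}, horner_mx C p ^+ d = C.
Proof.
move=> d_gt0 C_unit.
have [|p /dvdpP[s def_s]] := @exists_root_mod_poly K d (char_poly C) d_gt0.
  rewrite -eigenvalue_root_char /eigenvalue /eigenspace raddf0 subr0.
  by rewrite kermx_eq0 negbK row_free_unit.
exists p; apply/eqP; rewrite -subr_eq0 -{2}[C]horner_mx_X -rmorphXn -rmorphB def_s.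
by rewrite rmorphM /= Cayley_Hamilton mulr0.
Qed.

(** * Homogeneous polynomials, their gradients and Jacobian ideals *)

Section Polynomials.

Variables (K : comNzRingType) (n : nat).
Implicit Types (f g : {mpoly K[n]}) (i : 'I_n).

Lemma dhomog_mderiv d i f : f \is d.-homog -> f^`M(i) \is d.-1.-homog.
Proof.
move=> hf; apply/dhomogP => m; rewrite mcoeff_msupp mcoeff_deriv => nz.
have : (m + U_(i))%MM \in msupp f.
  by rewrite mcoeff_msupp; apply: contraNN nz => /eqP ->; rewrite mul0rn.
by move/(dhomog_mf hf); rewrite /= mdegD mdeg1 addn1 => <-.
Qed.

Lemma dhomog0_mpolyC f : f \is 0.-homog -> f = (f@_0%MM)%:MP.
Proof.
move=> hf; apply/mpolyP => m; rewrite mcoeffC.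
have [->|m_neq0] := eqVneq m 0%MM; first by rewrite mulr1.
by rewrite (dhomog_nemf_coeff hf) ?mdeg_eq0 // mulr0.
Qed.

Lemma euler_homog d f : f \is d.-homog -> f *+ d = \sum_i 'X_i * f^`M(i).
Proof.
move=> hf; rewrite {1}[f]mpolyE -sumrMnl.
have -> : \sum_i 'X_i * f^`M(i) =
    \sum_(m <- msupp f) \sum_i 'X_i * (f@_m *: 'X_[m])^`M(i).
  rewrite exchange_big /=; apply: eq_bigr => i _.
  by rewrite {1}[f]mpolyE raddf_sum /= mulr_sumr.
rewrite !big_seq; apply: eq_bigr => m m_f.
rewrite -(dhomog_mf hf m_f) /= mdegE -sumrMnr; apply: eq_bigr => i _.
rewrite mderivZ mderivX -!scalerAr -mpolyXD scalerMnr.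
(* If X_i does not divide the monomial, the subtraction of exponents truncates, but the coefficient
   [m i] is zero. *)
have [->|mi] := eqVneq (m i) 0%N; first by rewrite scale0r.
by rewrite addmC submK ?scaler_nat // lep1mP.
Qed.

(** A splitting m = k1 + k2 contributes only if k2 has degree d, the degree of m, which forces k1 =
    0. *)
Lemma mcoeff0M_homog d f g m :
  g \is d.-homog -> mdeg m = d -> (f * g)@_m = f@_0%MM * g@_m.
Proof.
move=> hg hm; rewrite mcoeffM.
have lt0 : (mdeg (0 : 'X_{1..n}) < (mdeg m).+1)%N by rewrite mdeg0.
have ltm : (mdeg m < (mdeg m).+1)%N by [].
rewrite (bigD1 (BMultinom lt0, BMultinom ltm)) /= ?add0m // big1 ?addr0 //.
case=> k1 k2 /= /andP[/eqP def_m].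
rewrite xpair_eqE negb_and -[k1 == _]val_eqE -[k2 == _]val_eqE /= => ne.
rewrite (dhomog_nemf_coeff hg) ?mulr0 //=; apply: contraTneq ne => k2d.
have deg_k : (mdeg k1 + mdeg k2 = d)%N by rewrite -mdegD -def_m.
have /eqP : mdeg k1 = 0%N by apply: (@addIn d); rewrite -{1}k2d deg_k.
rewrite mdeg_eq0 => /eqP k10; move: def_m; rewrite k10 add0m => def_m.
rewrite negb_or !negbK eqxx /=; apply/eqP; exact: esym.
Qed.

(** All the partial derivatives have degree d - 1, so in that degree only the constant terms of the
    ideal coefficients survive. *)
Lemma jacobian_ideal_gradient d f g (i : 'I_n) :
    f \is d.-homog -> g \is d.-homog -> jacobian_ideal g f^`M(i) ->
  exists a : 'I_n -> K, f^`M(i) = \sum_j a j *: g^`M(j).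
Proof.
move=> hf hg [c def_f]; exists (fun j => (c j)@_0%MM); apply/mpolyP => m.
have [hm|hm] := eqVneq (mdeg m) d.-1.
  rewrite def_f !raddf_sum; apply: eq_bigr => j _ /=.
  by rewrite (mcoeff0M_homog _ (dhomog_mderiv j hg) hm) mcoeffZ.
rewrite (dhomog_nemf_coeff (dhomog_mderiv i hf) hm) raddf_sum big1 // => j _.
by rewrite /= mcoeffZ (dhomog_nemf_coeff (dhomog_mderiv j hg) hm) mulr0.
Qed.

End Polynomials.

(** The two families of partial derivatives span the same space. Their coefficient matrices thus
    have equal row spaces and differ by an invertible factor, even when the partial derivatives are
    linearly dependent. *)
Lemma eq_jacobian_gradient (K : fieldType) (n d : nat) (f g : {mpoly K[n]}) :
    f \is d.-homog -> g \is d.-homog ->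
    (forall p, jacobian_ideal f p <-> jacobian_ideal g p) ->
  exists2 A : 'M[K]_n, A \in unitmx &
    forall i, f^`M(i) = \sum_j A i j *: g^`M(j).
Proof.
move=> hf hg hJ.
(* The bound d + 1 leaves room for the degree [d.-1] even when d = 0. *)
pose T := 'X_{1..n < d.+1}.
pose M (h : {mpoly K[n]}) :=
  \matrix_(i < n, k < #|{: T}|) (h^`M(i))@_(val (enum_val k)).
have sub h1 h2 : h1 \is d.-homog -> h2 \is d.-homog ->
    (forall p, jacobian_ideal h1 p -> jacobian_ideal h2 p) -> (M h1 <= M h2)%MS.
  move=> hh1 hh2 J12; apply/row_subP => i.
  have [|a def_h1] := @jacobian_ideal_gradient K n d h1 h2 i hh1 hh2.
    apply: J12; exists (fun j => (j == i)%:R).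
    by rewrite (bigD1 i) //= eqxx mul1r big1 ?addr0 // => j /negPf->; rewrite mul0r.
  apply/submxP; exists (\row_j a j); apply/rowP => k; rewrite !mxE def_h1 raddf_sum.
  by apply: eq_bigr => j _; rewrite /= mcoeffZ !mxE.
have /eqmxMunitP[A A_unit def_M] : (M f == M g)%MS.
  by rewrite !sub // => p /hJ.
exists A => // i; apply/mpolyP => m.
have [hm|hm] := eqVneq (mdeg m) d.-1.
  have ltm : (mdeg m < d.+1)%N by rewrite hm ltnS leq_pred.
  have := congr1 (fun N : 'M_(_, _) => N i (enum_rank (BMultinom ltm))) def_M.
  rewrite !mxE enum_rankK /= => ->; rewrite raddf_sum.
  by apply: eq_bigr => j _; rewrite /= mcoeffZ !mxE enum_rankK.
rewrite (dhomog_nemf_coeff (dhomog_mderiv i hf) hm) raddf_sum big1 // => j _.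
by rewrite /= mcoeffZ (dhomog_nemf_coeff (dhomog_mderiv j hg) hm) mulr0.
Qed.

Lemma mpoly_mulrnI (K : numFieldType) (n d : nat) :
  injective (fun p : {mpoly K[n]} => p *+ d.+1).
Proof.
move=> p q eq_pq; apply/mpolyP => m; have := congr1 (mcoeff m) eq_pq.
rewrite !mcoeffMn -[p@_m *+ _]mulr_natr -[q@_m *+ _]mulr_natr.
by move/mulIf; apply; rewrite pnatr_eq0.
Qed.

(** * Gradients, Hessians and self-adjoint substitutions *)

Section Gradient.

Variables (K : numFieldType) (n' : nat).
Local Notation n := n'.+1.
Local Notation mxC := (map_mx (@mpolyC n K)).
Implicit Types (B C : 'M[K]_n) (f g h : {mpoly K[n]}).

Definition gradient h : 'rV[{mpoly K[n]}]_n := \row_j h^`M(j).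
Definition hessian h : 'M[{mpoly K[n]}]_n := \matrix_(i, j) h^`M(i)^`M(j).
Definition mpoly_vars : 'cV[{mpoly K[n]}]_n := \col_i 'X_i.

(** Self-adjointness of [B] for the symmetric bilinear form that the Hessian of [h] defines at each
    point; this replaces the multilinear form of [h]. *)
Definition hess_sym B h := (mxC B)^T *m hessian h = hessian h *m mxC B.

Lemma tr_hessian h : (hessian h)^T = hessian h.
Proof. by apply/matrixP => i j; rewrite !mxE mderiv_comm. Qed.

(* C^T H_g = H_f is symmetric. *)
Lemma hess_sym_gradient C f g :
  gradient f = gradient g *m mxC C -> hess_sym C g.
Proof.
move=> def_f; have hess_f : hessian f = (mxC C)^T *m hessian g.
  apply/matrixP => i k; have := congr1 (fun u : 'rV_n => u 0 i) def_f.
  rewrite !mxE => ->; rewrite raddf_sum; apply: eq_bigr => j _.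
  by rewrite !mxE mulrC /= mderiv_mulC.
rewrite /hess_sym -hess_f -[LHS]tr_hessian hess_f trmx_mul trmxK.
by rewrite tr_hessian.
Qed.

(** The entries of [B] are constants and partial derivatives commute, so the identity can be
    differentiated entrywise. *)
Lemma hess_sym_mderiv B h i : hess_sym B h -> hess_sym B h^`M(i).
Proof.
move=> Bh; apply/matrixP => j k.
have D a b : h^`M(i)^`M(a)^`M(b) = h^`M(a)^`M(b)^`M(i).
  by rewrite (mderiv_comm i a) (mderiv_comm i b).
transitivity (((mxC B)^T *m hessian h) j k)^`M(i).
  rewrite !mxE raddf_sum; apply: eq_bigr => l _.
  by rewrite !mxE /= mderiv_mulC D.
rewrite Bh !mxE raddf_sum; apply: eq_bigr => l _.
by rewrite !mxE /= mulrC mderiv_mulC D mulrC.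
Qed.

(** Transposition reverses products, so a product of self-adjoint matrices is self-adjoint when they
    commute, as polynomials in [C] do. *)
Lemma hess_sym_horner C h p : hess_sym C h -> hess_sym (horner_mx C p) h.
Proof.
rewrite /hess_sym => Ch; elim/poly_ind: p => [|p c IHp].
  by rewrite rmorph0 map_mx0 trmx0 mul0mx mulmx0.
rewrite rmorphD rmorphM /= horner_mx_X horner_mx_C map_mxD map_mxM map_scalar_mx /=.
rewrite linearD /= mulmxDl mulmxDr trmx_mul -mulmxA IHp mulmxA Ch -mulmxA.
rewrite tr_scalar_mx scalar_mxC -!map_mxM; congr (_ *m map_mx _ _ + _).
exact/comm_mx_horner/comm_mx_refl.
Qed.

Lemma euler_gradient d h : h \is d.-homog -> h *+ d = (gradient h *m mpoly_vars) 0 0.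
Proof.
move/euler_homog->; rewrite mxE; apply: eq_bigr => i _.
by rewrite !mxE mulrC.
Qed.

(** Euler's formula for each partial derivative, which has degree e. *)
Lemma euler_hessian e h : h \is e.+1.-homog ->
  mpoly_vars^T *m hessian h = gradient h *+ e.
Proof.
move=> hh; apply/rowP => k; rewrite mulmxnE !mxE.
rewrite (euler_homog (dhomog_mderiv k hh)); apply: eq_bigr => i _.
by rewrite !mxE mderiv_comm.
Qed.

Lemma lin_substXU B i : lin_subst B 'X_i = (mxC B *m mpoly_vars) i 0.
Proof.
rewrite /lin_subst comp_mpolyXU -tnth_nth tnth_map tnth_ord_tuple mxE.
by apply: eq_bigr => j _; rewrite !mxE mul_mpolyC.
Qed.

Lemma euler_lin_subst B d h : h \is d.-homog ->
  lin_subst B h *+ d =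
    (map_mx (lin_subst B) (gradient h) *m mxC B *m mpoly_vars) 0 0.
Proof.
move=> hh; rewrite -mulmxA mxE /lin_subst -raddfMn (euler_homog hh) raddf_sum.
apply: eq_bigr => i _ /=.
by rewrite rmorphM /= [map_mx _ _ _ _]mxE [gradient _ _ _]mxE -lin_substXU mulrC.
Qed.

(* Seen as a symmetric multilinear form, h satisfies
   h(B x1, x2, ...) = h(x1, B x2, ...), so all the factors B of h(Bx, ..., Bx)
   can be moved to a single slot. *)
Lemma gradient_lin_subst B e h : h \is e.+1.-homog -> hess_sym B h ->
  map_mx (lin_subst B) (gradient h) = gradient h *m mxC B ^+ e.
Proof.
elim: e h => [|e IHe] h hh Bh; apply/rowP => k.
  rewrite expr0 mulmx1 !mxE /lin_subst.
  have := dhomog_mderiv k hh; rewrite /= => /dhomog0_mpolyC->.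
  by rewrite comp_mpolyC.
have hk := dhomog_mderiv k hh.
(* The rows of the Hessian are the gradients of the partial derivatives, to which the induction
   hypothesis applies. *)
have hess_subst : map_mx (lin_subst B) (hessian h) = hessian h *m mxC B ^+ e.
  apply/row_matrixP => j; rewrite -map_row row_mul.
  have -> : row j (hessian h) = gradient h^`M(j) by apply/rowP => l; rewrite !mxE.
  exact: IHe (dhomog_mderiv j hh) (hess_sym_mderiv j Bh).
apply: (@mpoly_mulrnI _ _ e); rewrite /= [map_mx _ _ _ _]mxE [gradient h _ _]mxE.
rewrite (euler_lin_subst B hk).
have -> : gradient h^`M(k) = (col k (hessian h))^T.
  by apply/rowP => j; rewrite !mxE mderiv_comm.
(* With H the Hessian, the scalar is x^T B^T H B^e e_k. Self-adjointness replaces B^T H by H B, and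
   x^T H = (e+1) grad h leaves (e+1) times entry k of grad h B^(e+1). *)
rewrite -map_trmx map_col hess_subst -[_ *m mpoly_vars]trmxK mxE.
rewrite !trmx_mul trmxK colE !mulmxA -(mulmxA _ _ (hessian h)) Bh !mulmxA.
rewrite (euler_hessian hh) -colE mxE -mulmxA -[mxC B *m _]/(mxC B * _) -exprS.
by rewrite -[gradient h *+ _]scaler_nat -scalemxAl mxE mulr_natl.
Qed.

(** By Euler's formula both sides, times d + 1, equal grad g B^(d+1) x. *)
Lemma lin_subst_eq B d f g :
    f \is d.+1.-homog -> g \is d.+1.-homog -> hess_sym B g ->
    gradient f = gradient g *m mxC (B ^+ d.+1) ->
  f = lin_subst B g.
Proof.
move=> hf hg Bg def_f; apply: (@mpoly_mulrnI _ _ d) => /=.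
rewrite (euler_gradient hf) (euler_lin_subst B hg) (gradient_lin_subst hg Bg).
by rewrite def_f rmorphXn exprSr mulmxA.
Qed.

End Gradient.

Lemma eq_jacobian_right_equivalent (K : numClosedFieldType) (n d : nat)
    (f g : {mpoly K[n.+1]}) :
    f \is d.+1.-homog -> g \is d.+1.-homog ->
    (forall p, jacobian_ideal f p <-> jacobian_ideal g p) ->
  right_equivalent f g.
Proof.
move=> hf hg hJ; have [A A_unit def_f] := eq_jacobian_gradient hf hg hJ.
(* Gradients are rows here, so [A] acts on them by its transpose on the right. *)
have AT_unit : A^T \in unitmx by rewrite unitmx_tr.
have [p pC] := exists_unitmx_root (ltn0Sn d) AT_unit.
set B := horner_mx _ p in pC.
have B_unit : B \in unitmx.
  by move: AT_unit; rewrite -pC exprS -mulmxE unitmx_mul => /andP[].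
have grad_f : gradient f = gradient g *m map_mx (@mpolyC _ _) A^T.
  apply/rowP => i; rewrite !mxE def_f; apply: eq_bigr => j _.
  by rewrite !mxE mulrC mul_mpolyC.
exists B => //; apply: lin_subst_eq hf hg _ _; last by rewrite pC.
exact/hess_sym_horner/(hess_sym_gradient grad_f).
Qed.

Theorem theorem3p2 (R : realType) (n d : nat) (hn : (1 <= n)%N) (hd : (1 <= d)%N)
    (f g : {mpoly R[i][n]}) (hf : f \is d.-homog) (hg : g \is d.-homog)
    (hJ : forall p : {mpoly R[i][n]}, jacobian_ideal f p <-> jacobian_ideal g p) :
  right_equivalent f g.
Proof.
case: n hn f g hf hg hJ => // n' _ f g hf hg hJ.
case: d hd hf hg => // d' _ hf hg.
exact: eq_jacobian_right_equivalent hf hg hJ.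
Qed.
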